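(* Suppose internal energy $\mathcal U$ and unresolved energy $\mathcal E_\alpha$ close a total-energy balance. For any adapted semimartingale $\chi$, the replacement $$\mathrm d\mathcal U\mapsto\mathrm d\mathcal U+\mathrm d\chi,\qquad \mathrm d\mathcal E_\alpha\mapsto\mathrm d\mathcal E_\alpha-\mathrm d\chi$$ leaves the total energy unchanged. The first law alone therefore does not fix the internal state or entropy production.
   Context: The setting is a stochastic model of incompressible flow in which particles follow $\mathrm d\bm x_t=\bm u\,\mathrm dt+\bm\alpha\,\mathrm dW_t$, with $\bm u$ the resolved drift, $\bm\alpha$ the displacement volatility and $W_t$ a Brownian motion. $\mathcal U$ is the internal energy and $\mathcal E_\alpha$ the energy of the unresolved motion; both enter the total energy additively (together with the resolved kinetic energy), and ''close a total-energy balance'' means that with them included the total energy obeys a balance law. ''The first law'' is this total-energy balance. Entropy production is meant in the usual thermodynamic (Clausius–Duhem) sense; determining it would additionally require a Gibbs relation, a heat flux, boundary covariations and a fluctuation–dissipation law. *)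

(* Defs.v *)
From HB Require Import structures.
From mathcomp Require Import all_boot all_order all_algebra.
From mathcomp Require Import all_classical all_reals all_analysis.

Set Implicit Arguments.
Unset Strict Implicit.
Unset Printing Implicit Defensive.

Import Order.TTheory GRing.Theory Num.Theory.
Import numFieldNormedType.Exports.

Local Open Scope classical_set_scope.
Local Open Scope ring_scope.

(* Time is the half-line 0 <= t.  A process is a total function of t : R, but
   no definition below ever constrains or reads its values at negative t. *)
Definition process (R : realType) (T : Type) := R -> T -> R.

Section StochasticProcesses.
Context {R : realType} {d : measure_display} {T : measurableType d}.
Variable P : probability T R.
Variable F : R -> set (set T).

(* Completeness and right-continuity of F are not required; path properties
   are therefore asked for almost surely. *)
Definition filtration : Prop :=
  [/\ forall t, 0 <= t -> sigma_algebra [set: T] (F t),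
      forall t, 0 <= t -> F t `<=` @measurable d T &
      forall s t, 0 <= s -> s <= t -> F s `<=` F t].

Definition adapted (X : process R T) : Prop :=
  forall t, 0 <= t -> forall B : set R, measurable B -> F t (X t @^-1` B).

Definition indistinguishable (X Y : process R T) : Prop :=
  {ae P, forall w, forall t, 0 <= t -> X t w = Y t w}.

Definition same_initial_value (X Y : process R T) : Prop :=
  {ae P, forall w, X 0 w = Y 0 w}.

(* dX = dY, i.e. equality of all increments. *)
Definition same_differential (X Y : process R T) : Prop :=
  {ae P, forall w, forall s t, 0 <= s -> s <= t ->
    X t w - X s w = Y t w - Y s w}.

Definition cadlag_path (f : R -> R) : Prop :=
  (forall t, 0 <= t -> f x @[x --> t^'+] --> f t) /\
  (forall t, 0 < t -> cvg (f x @[x --> t^'-])).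

Definition stopping_time (tau : T -> \bar R) : Prop :=
  (forall w, (0 <= tau w)%E) /\
  forall t, 0 <= t -> F t [set w | (tau w <= t%:E)%E].

Definition stopped (tau : T -> \bar R) (X : process R T) : process R T :=
  fun t w => X (fine (Order.min t%:E (tau w))) w.

(* The last clause is E[M_t | F_s] = M_s, in its defining integral form. *)
Definition martingale (M : process R T) : Prop :=
  [/\ adapted M,
      forall t, 0 <= t -> P.-integrable [set: T] (EFin \o M t) &
      forall s t, 0 <= s -> s <= t -> forall A, F s A ->
        (\int[P]_(w in A) (M t w)%:E = \int[P]_(w in A) (M s w)%:E)%E].

Definition local_martingale (M : process R T) : Prop :=
  [/\ adapted M, {ae P, forall w, cadlag_path (M ^~ w)} &
      exists tau : nat -> T -> \bar R,
        [/\ forall n, stopping_time (tau n),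
            {ae P, forall w, forall n, (tau n w <= tau n.+1 w)%E},
            {ae P, forall w, tau n w @[n --> \oo] --> +oo%E} &
            forall n, martingale (stopped (tau n) M)]].

Definition finite_variation_process (A : process R T) : Prop :=
  [/\ adapted A, {ae P, forall w, cadlag_path (A ^~ w)} &
      {ae P, forall w, forall t, 0 <= t -> bounded_variation 0 t (A ^~ w)}].

Definition semimartingale (X : process R T) : Prop :=
  adapted X /\
  exists M A : process R T,
    [/\ local_martingale M, same_initial_value M (fun _ _ => 0),
        finite_variation_process A, same_initial_value A (fun _ _ => 0) &
        indistinguishable X (fun t w => X 0 w + M t w + A t w)].

End StochasticProcesses.

Section Energetics.
Context {R : realType} {d : measure_display} {T : measurableType d}.
Variable P : probability T R.

(* K, U, Ea: kinetic energy of the resolved drift, internal energy, energy of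
   the unresolved motion. *)
Definition total_energy (K U Ea : process R T) : process R T :=
  fun t w => K t w + U t w + Ea t w.

(* d(K + U + Ea) = dB, where B is the energy supplied to the body. *)
Definition first_law (K B U Ea : process R T) : Prop :=
  same_differential P (total_energy K U Ea) B.

(* dU' = dU + dchi and dEa' = dEa - dchi; only the differentials are replaced,
   so the initial energies are kept. *)
Definition energy_replacement (chi U Ea U' Ea' : process R T) : Prop :=
  [/\ same_differential P U' (fun t w => U t w + chi t w),
      same_differential P Ea' (fun t w => Ea t w - chi t w),
      same_initial_value P U' U &
      same_initial_value P Ea' Ea].

(* The quantity is presented as a relation: [Q U X] says that X is its value
   when the internal energy is U. *)
Definition first_law_fixes (F : R -> set (set T)) (K B U Ea : process R T)
    (Q : process R T -> process R T -> Prop) : Prop :=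
  forall U' Ea' : process R T,
    semimartingale P F U' -> semimartingale P F Ea' ->
    same_initial_value P U' U -> same_initial_value P Ea' Ea ->
    first_law K B U' Ea' ->
    forall X X', Q U X -> Q U' X' -> indistinguishable P X' X.

Definition internal_state (U X : process R T) : Prop := indistinguishable P X U.

(* Gibbs relation theta ds = du at fixed density (incompressibility), on the
   range u > u0 of admissible internal energies, with positive temperature
   theta and nonnegative heat capacity. *)
Definition gibbs_relation (u0 : \bar R) (s theta : R -> R) : Prop :=
  [/\ forall u, (u0 < u%:E)%E -> 0 < theta u,
      forall u, (u0 < u%:E)%E -> is_derive u 1 s (theta u)^-1 &
      forall u v, (u0 < u%:E)%E -> u <= v -> theta u <= theta v].

(* Clausius-Duhem: the entropy produced up to t is the increase of entropy
   minus the entropy carried in by the heat, where q is the rate of heat inflow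
   (minus the outward heat flux integrated over the boundary). *)
Definition entropy_production (u0 : \bar R) (s theta : R -> R)
    (q U Sigma : process R T) : Prop :=
  {ae P, forall w, forall t, 0 <= t ->
    [/\ (u0 < (U t w)%:E)%E,
        lebesgue_measure.-integrable `[0, t]
          (fun r => (q r w / theta (U r w))%:E) &
        Sigma t w = s (U t w) - s (U 0 w)
          - \int[lebesgue_measure]_(r in `[0, t]) (q r w / theta (U r w))]}.

End Energetics.

(* Main.v *)
(* Along a replacement the two changes +chi and -chi cancel in the total energy.
   For non-uniqueness, exchange a unit jump of energy at time 1: U becomes
   U + 1_{t >= 1} and Ea becomes Ea - 1_{t >= 1}.  The past of U is untouched,
   so the entropy carried in by the heat over [0, 1] is unchanged (the integrand
   changes at the single time 1 only), while s(U_1) strictly increases because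
   s' = 1 / theta > 0.  Hence the entropy produced up to time 1 strictly
   increases, whatever the heat inflow q. *)
Require Import Defs.
From HB Require Import structures.
From mathcomp Require Import all_boot all_order all_algebra.
From mathcomp Require Import all_classical all_reals all_analysis.
From mathcomp Require Import measurable_realfun lra.

Set Implicit Arguments.
Unset Strict Implicit.
Unset Printing Implicit Defensive.

Import Order.TTheory GRing.Theory Num.Theory.
Import numFieldNormedType.Exports.

Local Open Scope classical_set_scope.
Local Open Scope ring_scope.

(** * Path regularity: measurability of right-continuous paths, and the unit jump *)

Section RealPaths.
Context {R : realType}.
Implicit Types (f g c : R -> R) (t u v : R).

(* [f] is the pointwise limit of [x |-> f ((floor (n x) + 1) / n)], which is
   constant on each interval [k / n, (k + 1) / n[. *)
Lemma right_continuous_measurable f :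
  (forall t, 0 <= t -> f x @[x --> t^'+] --> f t) ->
  measurable_fun (`[0, +oo[ : set R) f.
Proof.
move=> fr.
pose h (n : nat) (x : R) : R := (Num.truncn (x * n.+1%:R)).+1%:R / n.+1%:R.
have h_itv n x : 0 <= x -> x < h n x <= x + n.+1%:R^-1.
  move=> x0; have n0 : (0 : R) < n.+1%:R by rewrite ltr0n.
  have /andP[lo hi] : (Num.truncn (x * n.+1%:R))%:R <= x * n.+1%:R <
                      (Num.truncn (x * n.+1%:R)).+1%:R.
    by apply: truncn_itv; rewrite mulr_ge0// ltW.
  rewrite /h ltr_pdivlMr// hi /= ler_pdivrMr// mulrDl mulVf ?gt_eqF//.
  by rewrite -natr1 lerD2r.
apply: (@measurable_fun_cvg _ _ _ _ (fun n x => f (h n x))) => [n|x].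
- move=> _ Y mY.
  rewrite [X in measurable X](_ : _ = \bigcup_(k in [set k | Y (f (k.+1%:R / n.+1%:R))])
      `[k%:R / n.+1%:R, k.+1%:R / n.+1%:R[%classic); last first.
    have n0 : (0 : R) < n.+1%:R by rewrite ltr0n.
    apply/seteqP; split=> x /=; rewrite in_itv /= ?andbT.
      move=> [x0 Yx]; exists (Num.truncn (x * n.+1%:R)) => //=.
      rewrite in_itv/= ler_pdivrMr// ltr_pdivlMr//.
      by apply: truncn_itv; rewrite mulr_ge0// ltW.
    move=> [k /= Yk]; rewrite in_itv/= ler_pdivrMr// ltr_pdivlMr// => kx.
    split; last by rewrite /h (truncn_def kx).
    have /andP[k0 _] := kx.
    by rewrite -(pmulr_lge0 _ n0); apply: le_trans k0.
  by apply: bigcup_measurable => k _; apply: measurable_itv.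
- rewrite /= in_itv/= andbT => x0.
  (* The successor in [h] makes [h n x] strictly larger than [x], so [x] is approached from the
     right only and right continuity applies. *)
  have /cvg_at_rightP := fr x x0; apply; split=> [n|].
    by have /andP[] := h_itv n x x0.
  apply: (@squeeze_cvgr _ _ _ _ (fun=> x) (fun n => x + n.+1%:R^-1)).
  + by apply: nearW => n; have /andP[/ltW -> ->] := h_itv n x x0.
  + exact: cvg_cst.
  + rewrite -[X in _ --> X]addr0; apply: cvgD; first exact: cvg_cst.
    exact: cvg_harmonic.
Qed.

Lemma cadlag_pathD f g :
  cadlag_path f -> cadlag_path g -> cadlag_path (fun t => f t + g t).
Proof.
move=> [fr fl] [gr gl]; split=> t t0.
  by apply: cvgD; [exact: fr|exact: gr].
by apply: is_cvgD; [exact: fl|exact: gl].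
Qed.

Lemma cadlag_pathN f : cadlag_path f -> cadlag_path (fun t => - f t).
Proof.
by move=> [fr fl]; split=> t t0; [apply: cvgN; exact: fr|apply: is_cvgN; exact: fl].
Qed.

(** Taking the value 1 at the jump time itself gives right continuity, and makes the jump visible at
    time 1. *)
Definition unit_step t : R := if 1 <= t then 1 else 0.

Lemma unit_step_ge0 t : 0 <= unit_step t.
Proof. by rewrite /unit_step; case: ifP. Qed.

Lemma unit_step0 : unit_step 0 = 0.
Proof. by rewrite /unit_step ler10. Qed.

Lemma unit_step1 : unit_step 1 = 1.
Proof. by rewrite /unit_step lexx. Qed.

Lemma unit_step_lt1 t : t < 1 -> unit_step t = 0.
Proof. by move=> t1; rewrite /unit_step leNgt t1. Qed.

Lemma unit_step_cadlag : cadlag_path unit_step.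
Proof.
split=> t t0.
- apply: cvg_near_cst; rewrite /unit_step; case: ifPn => [t1|].
    by near=> x; rewrite (le_trans t1)//; near: x; exact: nbhs_right_ge.
  rewrite -ltNge => t1; near=> x; rewrite leNgt ifN// negbK.
  by near: x; exact: nbhs_right_lt.
(* The left limit at the jump time is 0, so [t = 1] belongs to the first case. *)
- have [t1|t1] := leP t 1.
    apply: (cvgP (0 : R)); apply: cvg_near_cst; near=> x; apply: unit_step_lt1.
    by apply: lt_le_trans t1; near: x; exact: nbhs_left_lt.
  apply: (cvgP (1 : R)); apply: cvg_near_cst; near=> x.
  rewrite /unit_step ifT//; near: x; exact: nbhs_left_ge.
Unshelve. all: by end_near. Qed.

Lemma unit_step_bounded_variation t : bounded_variation 0 t unit_step.
Proof.
apply: nondecreasing_bounded_variation => x y _ _ xy.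
rewrite /unit_step; case: ifPn => // x1; last by case: ifP.
by rewrite (le_trans x1 xy).
Qed.

End RealPaths.

(** * Consequences of the Gibbs relation *)

Section Entropy.
Context {R : realType} (u0 : \bar R) (s theta : R -> R).
Hypothesis gibbs : gibbs_relation u0 s theta.

(** Mean value theorem with [s' = 1 / theta > 0]; the admissible range is upward closed, so it
    contains all of [[u, v]]. *)
Lemma gibbs_entropy_incr (u v : R) : (u0 < u%:E)%E -> u < v -> s u < s v.
Proof.
have [theta_gt0 ds _] := gibbs => u0u uv.
have above x : u <= x -> (u0 < x%:E)%E by move=> ux; apply: lt_le_trans u0u _.
have deriv_s x : x \in `]u, v[ -> is_derive x 1 s (theta x)^-1.
  by rewrite in_itv/= => /andP[/ltW ux _]; exact/ds/above.
have cont_s : {within `[u, v], continuous s}.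
  apply: derivable_within_continuous => x; rewrite in_itv/= => /andP[ux _].
  by have [] := ds _ (above _ ux).
have [c] := MVT uv deriv_s cont_s.
rewrite in_itv/= => /andP[/ltW uc _] svu.
by rewrite -subr_gt0 svu mulr_gt0 ?subr_gt0// invr_gt0; apply/theta_gt0/above.
Qed.

Lemma measurable_temperature (D : set R) (f : R -> R) : measurable D ->
  measurable_fun D f -> (forall r, D r -> (u0 < (f r)%:E)%E) ->
  measurable_fun D (theta \o f).
Proof.
have [theta_gt0 _ theta_mono] := gibbs => mD mf u0f.
(* The Gibbs relation constrains [theta] only above [u0], where it is positive; the value 0
   elsewhere keeps [theta'] nondecreasing on the whole line, hence Borel. *)
pose theta' u := if (u0 < u%:E)%E then theta u else 0.
apply: (@eq_measurable_fun _ _ _ _ _ (theta' \o f)) => [r|].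
  by rewrite inE => Dr; rewrite /= /theta' u0f.
apply: (measurable_comp (F := setT)) => //.
apply: nondecreasing_measurable => // u v uv; rewrite /theta'.
case: ifPn => [u0u|_]; last by case: ifPn => // u0v; apply/ltW/theta_gt0.
by rewrite (lt_le_trans u0u) ?lee_fin//; apply: theta_mono.
Qed.

(** Nonnegative heat capacity makes the higher energy [g] the hotter one, so the flux at [g] is
    dominated in absolute value by the flux at [f]. *)
Lemma integrable_entropy_flux (D : set R) (q f g : R -> R) : measurable D ->
  measurable_fun D f -> measurable_fun D g ->
  (forall r, D r -> (u0 < (f r)%:E)%E) -> (forall r, D r -> f r <= g r) ->
  lebesgue_measure.-integrable D (fun r => (q r / theta (f r))%:E) ->
  lebesgue_measure.-integrable D (fun r => (q r / theta (g r))%:E).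
Proof.
have [theta_gt0 _ theta_mono] := gibbs => mD mf mg u0f fg int_f.
have u0g r : D r -> (u0 < (g r)%:E)%E.
  by move=> Dr; apply: (lt_le_trans (u0f r Dr)); rewrite lee_fin fg.
have m_qf : measurable_fun D (fun r => q r / theta (f r)).
  by apply/measurable_EFinP; exact: measurable_int int_f.
apply: le_integrable int_f => //; last first.
  move=> r Dr; have tf := theta_gt0 _ (u0f r Dr).
  have tg := theta_gt0 _ (u0g r Dr).
  rewrite !abse_EFin lee_fin !normrM ler_wpM2l// !gtr0_norm ?invr_gt0//.
  by rewrite lef_pV2 ?posrE//; apply: theta_mono; [exact: u0f|exact: fg].
apply/measurable_EFinP.
(* [x^-1] is written [x `^ (-1)], whose measurability is in the library; [q]
   itself is measurable only through [q / theta (f r)]. *)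
apply: (@eq_measurable_fun _ _ _ _ _
    (fun r => (q r / theta (f r)) * (theta (f r) * (theta (g r) `^ (-1))))).
  move=> r; rewrite inE => Dr; have tf := theta_gt0 _ (u0f r Dr).
  have tg := theta_gt0 _ (u0g r Dr).
  by rewrite powR_inv1 ?ltW// mulrA divfK// gt_eqF.
apply: measurable_funM => //.
apply: measurable_funM; first exact: measurable_temperature.
apply: (measurableT_comp (f := @powR R ^~ (-1)) (g := theta \o g)).
  exact: measurable_powR.
exact: measurable_temperature.
Qed.

End Entropy.

(** * Stochastic processes: adding a deterministic path, and path regularity *)

Section Processes.
Context {R : realType} {d : measure_display} {T : measurableType d}.
Variables (P : probability T R) (F : R -> set (set T)).
Implicit Types (X U : process R T) (c : R -> R).

(** A probability has mass one, so its almost-sure filter is proper. This lets incompatible almost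
    sure statements be refuted at a single sample point. *)
Lemma ae_nonempty (A : T -> Prop) : {ae P, forall w, A w} -> exists w, A w.
Proof.
have PT : (0 < P [set: T])%E by rewrite probability_setT.
have := ae_properfilter_algebraOfSetsType PT => PF; exact: filter_ex.
Qed.

Lemma adaptedD_deterministic X c :
  adapted F X -> adapted F (fun t w => X t w + c t).
Proof.
move=> aX t t0 B mB.
have mBc : measurable [set x | B (x + c t)].
  have mc : measurable_fun [set: R] (fun x : R => x + c t).
    by apply: measurable_funD; [exact: measurable_id|exact: measurable_cst].
  by have := mc measurableT B mB; rewrite setTI.
exact: aX mBc.
Qed.

(** The path [c] is absorbed into the finite variation part [A]; [c 0 = 0] keeps that part null at
    time 0. *)
Lemma semimartingaleD_deterministic X c : cadlag_path c ->
  (forall t, 0 <= t -> bounded_variation 0 t c) -> c 0 = 0 ->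
  semimartingale P F X -> semimartingale P F (fun t w => X t w + c t).
Proof.
move=> cc cbv c0 [aX [M [A [lM M0 [aA cA bvA] A0 XMA]]]].
split; first exact: adaptedD_deterministic.
exists M, (fun t w => A t w + c t); split => //.
- split; first exact: adaptedD_deterministic.
    by apply: filterS cA => w cAw; exact: cadlag_pathD.
  apply: filterS bvA => w bvAw t; rewrite le_eqVlt => /predU1P[<-|t0].
    exact: bounded_variationxx.
  by apply: bounded_variationD => //; [exact/bvAw/ltW|exact/cbv/ltW].
- by apply: filterS A0 => w A0w; rewrite A0w c0 addr0.
- apply: filterS XMA => w Xw t t0; by rewrite Xw// c0 addr0 !addrA.
Qed.

Lemma semimartingale_right_continuous X : semimartingale P F X ->
  {ae P, forall w, forall t, 0 <= t -> X x w @[x --> t^'+] --> X t w}.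
Proof.
move=> [_ [M [A [[_ cM _] _ [_ cA _] _ XMA]]]].
apply: filterS3 cM cA XMA => w [cMw _] [cAw _] Xw t t0.
have cvgMA : (X 0 w + M x w + A x w) @[x --> t^'+] --> X t w.
  rewrite (Xw t)//; apply: cvgD; last exact: cAw.
  by apply: cvgD; [exact: cvg_cst|exact: cMw].
(* The decomposition is known at nonnegative times only, which suffices to the right of [t >= 0]. *)
apply: cvg_trans cvgMA; apply: near_eq_cvg; near=> x.
by rewrite (Xw x)// (le_trans t0)//; near: x; exact: nbhs_right_ge.
Unshelve. all: by end_near. Qed.

(** * Exchange of energy at constant total, and failure of uniqueness *)

Lemma energy_replacement_total (K U Ea U' Ea' chi : process R T) :
  energy_replacement P chi U Ea U' Ea' ->
  indistinguishable P (total_energy K U' Ea') (total_energy K U Ea).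
Proof.
move=> [dU dE U0 E0].
near=> w => t t0; rewrite /total_energy.
have dUw : forall s t, 0 <= s -> s <= t -> U' t w - U' s w =
  U t w + chi t w - (U s w + chi s w) by near: w.
have dEw : forall s t, 0 <= s -> s <= t -> Ea' t w - Ea' s w =
  Ea t w - chi t w - (Ea s w - chi s w) by near: w.
have U0w : U' 0 w = U 0 w by near: w.
have E0w : Ea' 0 w = Ea 0 w by near: w.
(* Over [[0, t]] the two increments carry [chi t - chi 0] with opposite signs; the common initial
   values turn increments into values. *)
have := dUw 0 t (lexx _) t0; have := dEw 0 t (lexx _) t0.
rewrite U0w E0w; lra.
Unshelve. all: by end_near. Qed.

Lemma first_law_indistinguishable (K B U Ea U' Ea' : process R T) :
  indistinguishable P (total_energy K U' Ea') (total_energy K U Ea) ->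
  first_law P K B U Ea -> first_law P K B U' Ea'.
Proof.
apply: filterS2 => w EE law a b a0 ab.
by rewrite !EE ?(le_trans a0 ab)// law.
Qed.

(** Common core of both non-uniqueness claims: the pair obtained by moving [unit_step] from [Ea] to
    [U] is an admissible competitor, so a quantity that the jump raises at time 1 cannot be
    determined. *)
Lemma unit_jump_not_fixed (K B U Ea X X' : process R T)
    (Q : process R T -> process R T -> Prop) :
  semimartingale P F U -> semimartingale P F Ea -> first_law P K B U Ea ->
  Q U X -> Q (fun t w => U t w + unit_step t) X' ->
  {ae P, forall w, X 1 w < X' 1 w} -> ~ first_law_fixes P F K B U Ea Q.
Proof.
move=> sU sE law QX QX' XX' fixes.
have : indistinguishable P X' X.
  apply: (fixes (fun t w => U t w + unit_step t)
                (fun t w => Ea t w + - unit_step t)) => //.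
  - apply: semimartingaleD_deterministic => //; last exact: unit_step0.
      exact: unit_step_cadlag.
    by move=> t _; exact: unit_step_bounded_variation.
  - apply: (semimartingaleD_deterministic (c := fun t => - unit_step t)) => //.
    + by apply: cadlag_pathN; exact: unit_step_cadlag.
    + move=> t _; apply: bounded_variationN.
      exact: unit_step_bounded_variation.
    + by rewrite unit_step0 oppr0.
  - by apply: aeW => w; rewrite unit_step0 addr0.
  - by apply: aeW => w; rewrite unit_step0 oppr0 addr0.
  - apply: first_law_indistinguishable law; apply: aeW => w t t0.
    by rewrite /total_energy; lra.
move=> XX'_eq.
have /ae_nonempty[w [lt /(_ _ ler01) eq]] : {ae P, forall w,
    X 1 w < X' 1 w /\ forall t, 0 <= t -> X' t w = X t w}.
  by apply: filterS2 XX' XX'_eq.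
by rewrite eq ltxx in lt.
Qed.

(** The point beyond the strict increase is that an entropy production still exists after the jump:
    the raised energy stays admissible and its flux stays integrable. *)
Lemma entropy_production_unit_jump (u0 : \bar R) (s theta : R -> R)
    (q U Sigma : process R T) :
  gibbs_relation u0 s theta -> semimartingale P F U ->
  entropy_production P u0 s theta q U Sigma ->
  exists2 Sigma', entropy_production P u0 s theta q
      (fun t w => U t w + unit_step t) Sigma' &
    {ae P, forall w, Sigma 1 w < Sigma' 1 w}.
Proof.
move=> gibbs /semimartingale_right_continuous Ur SigmaE.
pose U' : process R T := fun t w => U t w + unit_step t.
have UU' t w : U t w <= U' t w by rewrite lerDl unit_step_ge0.
have intU' : {ae P, forall w, forall t, 0 <= t ->
    lebesgue_measure.-integrable `[0, t] (fun r => (q r w / theta (U' r w))%:E)}.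
  apply: filterS2 Ur SigmaE => w Urw Sw t t0.
  have [_ int_U _] := Sw t t0.
  have sub : `[0, t] `<=` (`[0, +oo[ : set R).
    by apply: subset_itvl; rewrite bnd_simp.
  apply: (integrable_entropy_flux gibbs (f := U ^~ w)) int_U => //.
  + apply: (measurable_funS _ sub) => //.
    exact: right_continuous_measurable.
  + apply: (measurable_funS _ sub) => //.
    apply: measurable_funD; apply: right_continuous_measurable => //.
    by have [] := @unit_step_cadlag R.
  + by move=> r /=; rewrite in_itv/= => /andP[r0 _]; have [] := Sw r r0.
exists (fun t w => s (U' t w) - s (U' 0 w)
  - \int[lebesgue_measure]_(r in `[0, t]) (q r w / theta (U' r w))).
- apply: filterS2 intU' SigmaE => w int_U' Sw t t0.
  have [u0U _ _] := Sw t t0; split=> //; last exact: int_U'.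
  by apply: lt_le_trans u0U _; rewrite lee_fin.
- apply: filterS2 intU' SigmaE => w int_U' Sw.
  have [u0U int_U ->] := Sw 1 ler01.
  have U'0 : U' 0 w = U 0 w by rewrite /U' unit_step0 addr0.
  have int_co (f : R -> R) : lebesgue_measure.-integrable `[0, 1] (EFin \o f) ->
      lebesgue_measure.-integrable `[0, 1[ (EFin \o f).
    by apply: integrableS => //; apply: subset_itvl; rewrite bnd_simp.
  (* Dropping the null endpoint 1 leaves [[0, 1[], where [U'] and [U] agree, so the two heat
     integrals coincide and only [s (U 1 w) < s (U' 1 w)] remains. *)
  rewrite U'0 -!Rintegral_itv_bndo_bndc.
  + rewrite [X in _ < _ - X](_ : _ =
        \int[lebesgue_measure]_(r in `[0, 1[) (q r w / theta (U r w))).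
      rewrite !ltrD2r; apply: (gibbs_entropy_incr gibbs) => //.
      by rewrite ltrDl unit_step1.
    apply: eq_Rintegral => r; rewrite inE/= in_itv/= => /andP[_ r1].
    by rewrite /U' unit_step_lt1// addr0.
  + by apply: int_co; exact: int_U'.
  + exact: int_co.
Qed.

End Processes.

Theorem proposition5p1 (R : realType) (d : measure_display)
    (T : measurableType d) (P : probability T R) (F : R -> set (set T))
    (K B U Ea : process R T)
    (hF : filtration F)
    (hU : semimartingale P F U) (hEa : semimartingale P F Ea)
    (hlaw : first_law P K B U Ea) :
  (forall chi : process R T, semimartingale P F chi ->
     forall U' Ea' : process R T, energy_replacement P chi U Ea U' Ea' ->
       indistinguishable P (total_energy K U' Ea') (total_energy K U Ea) /\
       first_law P K B U' Ea')
  /\ ~ first_law_fixes P F K B U Ea (internal_state P)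
  /\ (forall (u0 : \bar R) (s theta : R -> R) (q : process R T),
        gibbs_relation u0 s theta ->
        (exists Sigma, entropy_production P u0 s theta q U Sigma) ->
        ~ first_law_fixes P F K B U Ea
            (entropy_production P u0 s theta q)).
Proof.
split; [|split].
- move=> chi _ U' Ea' /(energy_replacement_total K) EE; split => //.
  exact: first_law_indistinguishable EE hlaw.
- apply: (unit_jump_not_fixed hU hEa hlaw (X := U)).
  + exact: aeW.
  + exact: aeW.
  + by apply: aeW => w; rewrite ltrDl unit_step1.
- move=> u0 s theta q gibbs [Sigma SigmaE].
  have [Sigma' SigmaE' lt] := entropy_production_unit_jump gibbs hU SigmaE.
  exact: (unit_jump_not_fixed hU hEa hlaw SigmaE SigmaE' lt).
Qed.
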